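(* Let $J$ and $X$ be finite, $\delta\in(0,1)$ and $\lambda\in(0,1)$. Along every path $(\alpha_t,x_t)_{t\ge0}$ induced by a stationary MPE $(\phi,z)$, with $h_t,H_t,Q_t,A_t$ as defined in the context: (i) $A_t\ge h_t$ for every $t\ge0$; (ii) $H_{t+1}\ge H_t$ for every $t\ge0$; (iii) there is $L\in\mathbb R$ such that $H_t\to L$, $h_t\to L$, $A_t\to L$ and $Q_t\to L$ as $t\to\infty$; (iv) for every integer $k\ge1$, the losses $h_t-U(\alpha_t,x_{t+k})$ are nonnegative and satisfy $$\sum_{t=0}^\infty\big[h_t-U(\alpha_t,x_{t+k})\big]\le\frac{(1-\lambda)(L-H_0)}{\lambda(1-\delta)^2\delta^{k-1}}\le\frac{(1-\lambda)(\overline u-\underline u)}{\lambda(1-\delta)^2\delta^{k-1}}.$$ In particular, for every fixed $k\ge1$, $h_t-U(\alpha_t,x_{t+k})\to0$ as $t\to\infty$.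
   Context: $J=\{1,\ldots,n\}$ and $X$ are nonempty finite sets (pure worldviews and actions) with payoffs $u_j(x)\in\mathbb R$; $\underline u=\min_{j,x}u_j(x)$, $\overline u=\max_{j,x}u_j(x)$. $\Delta^n=\{\alpha\in\mathbb R^n:\alpha^j\ge0,\ \sum_j\alpha^j=1\}$. $U(\alpha,x)=\sum_j\alpha^ju_j(x)$, $z^*(\alpha)=\arg\max_{x\in X}U(\alpha,x)$, $h(\alpha)=\max_{x\in X}U(\alpha,x)$. A stationary pure strategy is a pair of arbitrary maps $\phi:\Delta^n\to\Delta^n$, $z:\Delta^n\to X$ (no continuity or measurability assumed). With $\phi^k$ the $k$-fold iterate, put $$C_{\phi,z}(\beta;\alpha)=\sum_{k=0}^\infty\delta^k\big[(1-\lambda)U(\phi^k(\beta),z(\phi^k(\beta)))+\lambda U(\alpha,z(\phi^k(\beta)))\big].$$ A stationary MPE is a pair $(\phi,z)$ such that for every $\alpha\in\Delta^n$: $z(\alpha)\in z^*(\alpha)$, and $C_{\phi,z}(\phi(\alpha);\alpha)\ge C_{\phi,z}(\beta;\alpha)$ for every $\beta\in\Delta^n$. The induced path from $\alpha_0\in\Delta^n$ is $\alpha_{t+1}=\phi(\alpha_t)$, $x_t=z(\alpha_t)$. Along such a path define $$h_t=U(\alpha_t,x_t)=h(\alpha_t),\quad H_t=(1-\delta)\sum_{k=0}^\infty\delta^kh_{t+k},\quad Q_t=(1-\delta)\sum_{k=1}^\infty\delta^{k-1}U(\alpha_t,x_{t+k}),$$ $$A_t=(1-\lambda)H_{t+1}+\lambda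 Q_t=(1-\delta)C_{\phi,z}(\phi(\alpha_t);\alpha_t).$$ *)

(* Defs.v *)
From HB Require Import structures.
From mathcomp Require Import all_boot all_order all_algebra.
From mathcomp Require Import all_classical all_reals all_analysis.
From mathcomp Require Import ring lra.

Set Implicit Arguments.
Unset Strict Implicit.
Unset Printing Implicit Defensive.

Import Order.TTheory GRing.Theory Num.Theory.
Import numFieldNormedType.Exports.

Local Open Scope classical_set_scope.
Local Open Scope ring_scope.

Definition in_simplex (R : realType) (n : nat) (a : 'rV[R]_n) : bool :=
  [forall j, 0 <= a 0 j] && (\sum_j a 0 j == 1).

Definition simplex (R : realType) (n : nat) := {a : 'rV[R]_n | in_simplex a}.

Section Payoffs.
Context {R : realType} {n : nat} {X : finType}.
Implicit Types (u : 'I_n -> X -> R) (a : simplex R n).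

Definition U u a (x : X) : R := \sum_j val a 0 j * u j x.

Definition zstar u a : {set X} :=
  [set x | [forall y, U u a y <= U u a x]]%SET.

(* The seeds j0 and x0 only witness that the index sets are nonempty: each
   seed is itself one of the values over which the extremum is taken. *)
Definition hmax u (x0 : X) a : R := \big[Num.max/U u a x0]_x U u a x.

Definition umin u (j0 : 'I_n) (x0 : X) : R :=
  \big[Num.min/u j0 x0]_(p : 'I_n * X) u p.1 p.2.

Definition umax u (j0 : 'I_n) (x0 : X) : R :=
  \big[Num.max/u j0 x0]_(p : 'I_n * X) u p.1 p.2.

End Payoffs.

Section Equilibrium.
Context {R : realType} {n : nat} {X : finType}.
Variables (u : 'I_n -> X -> R) (delta lambda : R).
Variables (phi : simplex R n -> simplex R n) (z : simplex R n -> X).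

(* Infinite sums of reals are limits of partial sums (a junk value when these
   diverge); all those below converge absolutely for 0 < delta < 1, the
   payoffs being bounded: see is_cvg_discounted. *)
Definition C (b a : simplex R n) : R :=
  \big[+%R/0]_(0 <= k <oo) (delta ^+ k *
    ((1 - lambda) * U u (iter k phi b) (z (iter k phi b))
     + lambda * U u a (z (iter k phi b)))).

Definition stationary_MPE : Prop :=
  forall a, z a \in zstar u a /\ forall b, C b a <= C (phi a) a.

Variable a0 : simplex R n.

Definition path_alpha (t : nat) : simplex R n := iter t phi a0.

Definition path_x (t : nat) : X := z (path_alpha t).

Definition path_h (t : nat) : R := U u (path_alpha t) (path_x t).

Definition path_H (t : nat) : R :=
  (1 - delta) * \big[+%R/0]_(0 <= k <oo) (delta ^+ k * path_h (t + k)).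

Definition path_Q (t : nat) : R :=
  (1 - delta) *
    \big[+%R/0]_(1 <= k <oo)
      (delta ^+ (k - 1) * U u (path_alpha t) (path_x (t + k))).

Definition path_A (t : nat) : R :=
  (1 - lambda) * path_H t.+1 + lambda * path_Q t.

Lemma path_h_hmax (x0 : X) (t : nat) :
  stationary_MPE -> path_h t = hmax u x0 (path_alpha t).
Proof.
move=> mpe; have [+ _] := mpe (path_alpha t).
rewrite inE => /forallP zP; apply/eqP; rewrite eq_le; apply/andP; split.
  exact: le_bigmax_cond.
by apply: bigmax_le => [|x _]; exact: zP.
Qed.

Lemma normU_le (a : simplex R n) (x : X) :
  `|U u a x| <= \sum_j \sum_y `|u j y|.
Proof.
case: a => a /= a_simplex; have /andP[/forallP a_ge0 /eqP a_sum1] := a_simplex.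
apply: le_trans (ler_norm_sum _ _ _) _ => /=; apply: ler_sum => j _.
rewrite normrM ger0_norm //=.
have aj_le1 : a 0 j <= 1.
  by rewrite -a_sum1 (bigD1 j) //= lerDl sumr_ge0.
apply: le_trans (ler_piMl (normr_ge0 _) aj_le1) _.
by rewrite (bigD1 x) //= lerDl sumr_ge0.
Qed.

Lemma is_cvg_discounted (v : nat -> R) (M : R) : 0 < delta < 1 ->
  (forall k, `|v k| <= M) -> cvgn (series (fun k => delta ^+ k * v k)).
Proof.
move=> /andP[d_gt0 d_lt1] vM; apply: normed_cvg.
have M_ge0 : 0 <= M := le_trans (normr_ge0 _) (vM 0%N).
apply: (@series_le_cvg _ _ (geometric M delta)) => [k|k|k|] /=.
- exact: normr_ge0.
- by rewrite mulr_ge0 // exprn_ge0 // ltW.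
- rewrite normrM ger0_norm ?exprn_ge0 ?(ltW d_gt0) // mulrC.
  by rewrite ler_wpM2r ?exprn_ge0 ?(ltW d_gt0).
- by apply: is_cvg_geometric_series; rewrite gtr0_norm.
Qed.

Lemma path_A_C (t : nat) : 0 < delta < 1 ->
  path_A t = (1 - delta) * C (phi (path_alpha t)) (path_alpha t).
Proof.
move=> delta01; pose M := \sum_j \sum_y `|u j y|.
have path_shift k : iter k phi (phi (path_alpha t)) = path_alpha (t.+1 + k).
  by rewrite -iterSr /path_alpha -iterD addSnnS addnC.
pose f k := delta ^+ k * path_h (t.+1 + k).
pose g k := delta ^+ k * U u (path_alpha t) (path_x (t.+1 + k)).
have cf : cvgn (series f).
  by apply: (@is_cvg_discounted _ M) => // k; exact: normU_le.
have cg : cvgn (series g).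
  by apply: (@is_cvg_discounted _ M) => // k; exact: normU_le.
have CE : C (phi (path_alpha t)) (path_alpha t) =
    (1 - lambda) * limn (series f) + lambda * limn (series g).
  rewrite -[_ * limn (series f)]/((1 - lambda) *: _).
  rewrite -[_ * limn (series g)]/(lambda *: _).
  rewrite -!lim_seriesZ // -lim_seriesD; [|exact: is_cvg_seriesZ..].
  congr (limn _); apply/funext => m; apply: eq_bigr => k _.
  rewrite path_shift /f /g /path_h /path_x.
  by rewrite mulrDr; congr (_ + _); exact: mulrCA.
have QE : path_Q t = (1 - delta) * limn (series g).
  rewrite /path_Q; congr (_ * _); apply: cvg_lim => //.
  rewrite -(cvg_shiftS (fun m => \sum_(1 <= k < m) _)).
  rewrite [X in X @ _](_ : _ = series g) //; apply/funext => m.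
  by rewrite [LHS]big_add1 /=; apply: eq_bigr => k _; rewrite /g subn1 addnS.
rewrite /path_A /path_H QE CE -/(series f); ring.
Qed.

End Equilibrium.

(* Main.v *)
Require Import Defs.
From mathcomp Require Import all_boot all_order all_algebra.
From mathcomp Require Import all_classical all_reals all_analysis.
From mathcomp Require Import ring lra.

Import Order.TTheory GRing.Theory Num.Theory.
Import numFieldNormedType.Exports.

Local Open Scope classical_set_scope.
Local Open Scope ring_scope.

(** In state [alpha_t] the agent may deviate to [beta = alpha_t], i.e. repeat
    the current worldview once before resuming the path; this yields
    [(1 - delta) h_t + delta A_t], so optimality gives [h_t <= A_t]. As [x_t] is
    optimal for [alpha_t], [Q_t <= h_t], whence [h_t <= H_(t+1)]; since [H_t] is
    a convex combination of [h_t] and [H_(t+1)], [H] is nondecreasing and bounded,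
    and the other sequences are squeezed to its limit. Finally [h_t <= A_t] reads
    [lambda (h_t - Q_t) <= (1 - lambda) (H_(t+1) - h_t)], where [h_t - Q_t] is at
    least [(1 - delta) delta^(k-1)] times the loss at lag [k] and
    [H_(t+1) - h_t = (H_(t+1) - H_t) / (1 - delta)] telescopes. *)

(** The factor [1 - delta] makes the weights sum to 1. [path_H], [path_Q] and [(1 - delta) * C] are
    all of this form, so one recursion serves them all. *)
Definition discounted_avg (R : realType) (delta : R) (v : nat -> R) : R :=
  (1 - delta) * \big[+%R/0]_(0 <= k <oo) (delta ^+ k * v k).

(** * Discounted averages of bounded sequences *)

Section DiscountedAverage.
Context {R : realType}.
Variable delta : R.
Hypothesis delta01 : 0 < delta < 1.
Implicit Types (v : nat -> R) (M : R).

(** The bound [M] makes the series converge, so its limit is a genuine sum from which the first term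
    can be split off. *)
Lemma discounted_avg_recl v M : (forall k, `|v k| <= M) ->
  discounted_avg R delta v =
  (1 - delta) * v 0%N + delta * discounted_avg R delta (fun k => v k.+1).
Proof.
move=> vM; pose f k := delta ^+ k * v k; pose g k := delta ^+ k * v k.+1.
have cg : cvgn (series g).
  exact: (@is_cvg_discounted _ _ _ M).
have fE : limn (series f) = v 0%N + delta * limn (series g).
  apply: cvg_lim => //; rewrite -cvg_shiftS.
  rewrite [X in X @ _](_ : _ = fun m => v 0%N + delta * series g m).
    by apply: cvgD; [exact: cvg_cst | apply: cvgMr; exact: cg].
  apply/funext => m; rewrite /series /= big_nat_recl // /f expr0 mul1r.
  by rewrite mulr_sumr; congr (_ + _); apply: eq_bigr => k _; rewrite exprS mulrA.
by rewrite /discounted_avg -/(series f) -/(series g) fE; ring.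
Qed.

Lemma discounted_avg_le v w M N : (forall k, `|v k| <= M) ->
  (forall k, `|w k| <= N) -> (forall k, v k <= w k) ->
  discounted_avg R delta v <= discounted_avg R delta w.
Proof.
move=> vM wN vw; have /andP[d0 d1] := delta01.
apply: ler_wpM2l; first by rewrite subr_ge0 ltW.
apply: ler_lim; [exact: (@is_cvg_discounted _ _ _ M)..
  |exact: (@is_cvg_discounted _ _ _ N)|].
apply: nearW => m; apply: ler_sum => k _.
by rewrite ler_wpM2l // exprn_ge0 // ltW.
Qed.

Lemma discounted_avg_cst (c : R) : discounted_avg R delta (fun=> c) = c.
Proof.
have /andP[d0 d1] := delta01.
(* The tail of a constant sequence is itself, so the recursion becomes the linear equation
   [x = (1 - delta) * c + delta * x]. *)
have := @discounted_avg_recl (fun=> c) `|c| (fun=> lexx _).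
set x := discounted_avg _ _ _ => xE.
have d1' : 1 - delta != 0 by rewrite subr_eq0 gt_eqF.
by apply: (mulfI d1'); lra.
Qed.

Lemma discounted_avg_ub v M c : (forall k, `|v k| <= M) ->
  (forall k, v k <= c) -> discounted_avg R delta v <= c.
Proof.
move=> vM vc; rewrite -[leRHS]discounted_avg_cst.
exact: (@discounted_avg_le _ _ M `|c|).
Qed.

Lemma discounted_avg_lb v M c : (forall k, `|v k| <= M) ->
  (forall k, c <= v k) -> c <= discounted_avg R delta v.
Proof.
move=> vM vc; rewrite -[leLHS]discounted_avg_cst.
exact: (@discounted_avg_le _ _ `|c| M).
Qed.

(** The right-hand side averages the nonnegative gaps [c - v i], hence dominates the term at [k]
    alone. The induction varies [v], passing to its tail. *)
Lemma discounted_avg_gap v M c k : (forall i, `|v i| <= M) ->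
  (forall i, v i <= c) ->
  (1 - delta) * delta ^+ k * (c - v k) <= c - discounted_avg R delta v.
Proof.
have /andP[d0 d1] := delta01.
elim: k v => [|k IH] v vM vc; rewrite (discounted_avg_recl v M vM).
  have := @discounted_avg_ub (fun k => v k.+1) M c (fun k => vM _) (fun k => vc _).
  rewrite -(ler_pM2l d0) expr0 mulr1; lra.
have := IH (fun k => v k.+1) (fun k => vM _) (fun k => vc _).
rewrite -(ler_pM2l d0) exprS => gap.
have : 0 <= (1 - delta) * (c - v 0%N) by rewrite mulr_ge0 ?subr_ge0 // ltW.
lra.
Qed.

End DiscountedAverage.

(** * Bounds on expected payoffs *)

Section Payoffs.
Context {R : realType} {n : nat} {X : finType}.
Variables (j0 : 'I_n) (x0 : X) (u : 'I_n -> X -> R).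

Lemma U_bounds (a : simplex R n) (x : X) :
  umin u j0 x0 <= U u a x <= umax u j0 x0.
Proof.
case: a => a /= aP; have /andP[/forallP a_ge0 /eqP a_sum1] := aP.
(* As the weights sum to 1, both bounds become weighted sums, compared termwise. *)
rewrite -[umin _ _ _]mul1r -[umax _ _ _]mul1r -a_sum1 !mulr_suml /U /=.
apply/andP; split; apply: ler_sum => j _; apply: ler_wpM2l => //.
  exact: (bigmin_le_cond _ (fun p : 'I_n * X => u p.1 p.2) (j := (j, x))).
exact: (le_bigmax_cond _ (fun p : 'I_n * X => u p.1 p.2) (j := (j, x))).
Qed.

End Payoffs.

(** * Inequalities and limits along an equilibrium path *)

Section Path.
Context {R : realType} {n : nat} {X : finType}.
Variables (u : 'I_n -> X -> R) (delta lambda : R).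
Hypotheses (delta01 : 0 < delta < 1) (lambda01 : 0 < lambda < 1).
Variables (phi : simplex R n -> simplex R n) (z : simplex R n -> X).
Hypothesis mpe : stationary_MPE u delta lambda phi z.
Variable a0 : simplex R n.

Local Notation alpha := (path_alpha phi a0).
Local Notation x := (path_x phi z a0).
Local Notation h := (path_h u phi z a0).
Local Notation H := (path_H u delta phi z a0).
Local Notation Q := (path_Q u delta phi z a0).
Local Notation A := (path_A u delta lambda phi z a0).
Local Notation M := (\sum_j \sum_y `|u j y|).

(** The state moves on to [phi b] while the evaluating worldview [a] stays fixed. At [b = a] the
    current payoff collapses to [U u a (z a)]. *)
Lemma C_recl (b a : simplex R n) : C u delta lambda phi z b a =
  (1 - lambda) * U u b (z b) + lambda * U u a (z b)
  + delta * C u delta lambda phi z (phi b) a.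
Proof.
have /andP[d0 d1] := delta01; have /andP[l0 l1] := lambda01.
pose v k := (1 - lambda) * U u (iter k phi b) (z (iter k phi b))
  + lambda * U u a (z (iter k phi b)).
have vM k : `|v k| <= M.
  apply: le_trans (ler_normD _ _) _; rewrite !normrM.
  rewrite (gtr0_norm l0) gtr0_norm ?subr_gt0 //.
  rewrite [leRHS](_ : M = (1 - lambda) * M + lambda * M); last by ring.
  by apply: lerD; rewrite ler_pM2l ?subr_gt0 ?normU_le.
have := discounted_avg_recl delta delta01 v M vM.
have d1' : 1 - delta != 0 by rewrite subr_eq0 gt_eqF.
have -> : discounted_avg R delta (fun k => v k.+1) =
    (1 - delta) * C u delta lambda phi z (phi b) a.
  congr (_ * _); congr (limn _); apply/funext => m; apply: eq_bigr => k _.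
  by rewrite /v !iterSr.
rewrite [LHS]/(_ * C u delta lambda phi z b a) => vE.
apply: (mulfI d1'); rewrite [LHS]vE /v /=; ring.
Qed.

(** Reindexing the sum to start at 0 exposes [Q t] as a discounted average. *)
Lemma path_QE t : Q t =
  discounted_avg R delta (fun k => U u (alpha t) (x (t + k.+1)%N)).
Proof.
have cg : cvgn (series (fun k => delta ^+ k * U u (alpha t) (x (t + k.+1)%N))).
  by apply: (@is_cvg_discounted _ _ _ M) => // k; exact: normU_le.
congr (_ * _); apply: cvg_lim => //.
rewrite -(cvg_shiftS (fun m => \sum_(1 <= k < m) _)).
rewrite [X in X @ _](_ : _ =
  series (fun k => delta ^+ k * U u (alpha t) (x (t + k.+1)%N))) //.
by apply/funext => m; rewrite [LHS]big_add1; apply: eq_bigr => k _; rewrite subn1.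
Qed.

Lemma path_H_recl t : H t = (1 - delta) * h t + delta * H t.+1.
Proof.
have := discounted_avg_recl delta delta01 (fun k => h (t + k)%N) M
  (fun k => normU_le _ _ _).
rewrite addn0 => HE; rewrite [LHS]HE; congr (_ + _ * (_ * _)); congr (limn _).
by apply/funext => m; apply: eq_bigr => k _; rewrite addnS.
Qed.

Lemma path_h_ge t (y : X) : U u (alpha t) y <= h t.
Proof. by have [+ _] := mpe (alpha t); rewrite inE => /forallP. Qed.

Lemma path_Q_le_h t : Q t <= h t.
Proof.
rewrite path_QE; apply: (discounted_avg_ub _ delta01 _ M) => k.
  exact: normU_le.
exact: path_h_ge.
Qed.

Lemma path_h_le_A t : h t <= A t.
Proof.
have /andP[d0 d1] := delta01.
rewrite path_A_C //; have [_ /(_ (alpha t))] := mpe (alpha t).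
rewrite C_recl -[U u (alpha t) (z (alpha t))]/(h t); lra.
Qed.

Lemma path_h_le_HS t : h t <= H t.+1.
Proof.
have /andP[l0 l1] := lambda01.
have l1' : 0 < 1 - lambda by rewrite subr_gt0.
rewrite -(ler_pM2l l1'); have := path_h_le_A t; rewrite /path_A.
(* Replacing [Q t] by [h t] in [h t <= A t] leaves [(1 - lambda) * h t <= (1 - lambda) * H t.+1]. *)
have := ler_wpM2l (ltW l0) (path_Q_le_h t); lra.
Qed.

Lemma path_H_ndecr t : H t <= H t.+1.
Proof.
have /andP[d0 d1] := delta01; rewrite [leLHS]path_H_recl.
have d1' : 0 < 1 - delta by rewrite subr_gt0.
have := ler_wpM2l (ltW d1') (path_h_le_HS t); lra.
Qed.

Lemma path_H_bounds (j0 : 'I_n) (x0 : X) t :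
  umin u j0 x0 <= H t <= umax u j0 x0.
Proof.
apply/andP; split; [apply: (discounted_avg_lb _ delta01 _ M)
  | apply: (discounted_avg_ub _ delta01 _ M)] => k; try exact: normU_le.
all: by have /andP[] := U_bounds j0 x0 u (alpha (t + k)) (x (t + k)).
Qed.

(** The lag is [k.+1], so [delta] carries the exponent lag minus 1. One factor [1 - delta] comes
    from the weight of a single term in [Q t], the other from turning [H t.+1 - h t] into an
    increment of [H]. *)
Lemma path_loss_le k t :
  h t - U u (alpha t) (x (t + k.+1)%N) <=
  (1 - lambda) * (H t.+1 - H t) / (lambda * (1 - delta) ^+ 2 * delta ^+ k).
Proof.
have /andP[d0 d1] := delta01; have /andP[l0 l1] := lambda01.
have d1' : 0 < 1 - delta by rewrite subr_gt0.
rewrite ler_pdivlMr; last by rewrite !mulr_gt0 ?exprn_gt0.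
have := discounted_avg_gap delta delta01
  (fun k => U u (alpha t) (x (t + k.+1)%N)) M (h t) k
  (fun k => normU_le _ _ _) (fun k => path_h_ge _ _).
rewrite -path_QE; set l := h t - U _ _ _ => gap.
have hA : lambda * (h t - Q t) <= (1 - lambda) * (H t.+1 - h t).
  by have := path_h_le_A t; rewrite /path_A; lra.
have := ler_wpM2l (ltW l0) gap => /le_trans/(_ hA).
rewrite -(ler_pM2l d1') => /le_trans; rewrite expr2.
have -> : l * (lambda * ((1 - delta) * (1 - delta)) * delta ^+ k) =
  (1 - delta) * (lambda * ((1 - delta) * delta ^+ k * l)) by ring.
by apply; rewrite (path_H_recl t) le_eqVlt; apply/orP; left; apply/eqP; ring.
Qed.

Lemma path_cvg (L : R) : H t @[t --> \oo] --> L ->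
  [/\ h t @[t --> \oo] --> L, A t @[t --> \oo] --> L
    & Q t @[t --> \oo] --> L].
Proof.
move=> HL; have /andP[d0 d1] := delta01; have /andP[l0 l1] := lambda01.
have d1' : 1 - delta != 0 by rewrite subr_eq0 gt_eqF.
have HSL : H t.+1 @[t --> \oo] --> L by rewrite (cvg_shiftS H).
have hL : h t @[t --> \oo] --> L.
  (* [h] is recovered by solving the recursion for [H]. *)
  rewrite [X in X @ _](_ : _ = fun t => (1 - delta)^-1 * (H t - delta * H t.+1)).
    rewrite [L in _ --> L](_ : _ = (1 - delta)^-1 * (L - delta * L)); last by field.
    by apply: cvgMr; apply: cvgB => //; apply: cvgMr.
  by apply/funext => t; rewrite (path_H_recl t) addrK mulKf.
have AL : A t @[t --> \oo] --> L.
  apply: (@squeeze_cvgr _ _ _ _ h (fun t => H t.+1)) => //.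
  apply: nearW => t; rewrite path_h_le_A /=.
  have Qh : Q t <= H t.+1 := le_trans (path_Q_le_h t) (path_h_le_HS t).
  by have := ler_wpM2l (ltW l0) Qh; rewrite /path_A; lra.
split=> //.
(* [Q] is recovered by solving the definition of [A], as [lambda] is nonzero. *)
rewrite [X in X @ _](_ : _ = fun t => lambda^-1 * (A t - (1 - lambda) * H t.+1)).
  rewrite [L in _ --> L](_ : _ = lambda^-1 * (L - (1 - lambda) * L)).
    by apply: cvgMr; apply: cvgB => //; apply: cvgMr.
  by field; rewrite gt_eqF.
by apply/funext => t; rewrite /path_A addrC addKr mulKf ?gt_eqF.
Qed.

End Path.

Theorem theorem4 (R : realType) (n : nat) (X : finType)
    (j0 : 'I_n) (x0 : X) (u : 'I_n -> X -> R) (delta lambda : R)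
    (delta01 : 0 < delta < 1) (lambda01 : 0 < lambda < 1)
    (phi : simplex R n -> simplex R n) (z : simplex R n -> X)
    (mpe : stationary_MPE u delta lambda phi z) (a0 : simplex R n) :
  let alpha := path_alpha phi a0 in
  let x := path_x phi z a0 in
  let h := path_h u phi z a0 in
  let H := path_H u delta phi z a0 in
  let Q := path_Q u delta phi z a0 in
  let A := path_A u delta lambda phi z a0 in
  (forall t : nat, h t <= A t) /\
  (forall t : nat, H t <= H t.+1) /\
  exists L : R,
    (H t @[t --> \oo] --> L /\ h t @[t --> \oo] --> L /\
     A t @[t --> \oo] --> L /\ Q t @[t --> \oo] --> L) /\
    (forall k : nat, (1 <= k)%N ->
      let loss := fun t : nat => h t - U u (alpha t) (x (t + k)%N) in
      (forall t : nat, 0 <= loss t) /\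
      (cvgn (series loss) /\
       limn (series loss) <=
         (1 - lambda) * (L - H 0%N)
           / (lambda * (1 - delta) ^+ 2 * delta ^+ (k - 1))) /\
      (1 - lambda) * (L - H 0%N)
          / (lambda * (1 - delta) ^+ 2 * delta ^+ (k - 1))
        <= (1 - lambda) * (umax u j0 x0 - umin u j0 x0)
             / (lambda * (1 - delta) ^+ 2 * delta ^+ (k - 1)) /\
      loss t @[t --> \oo] --> (0 : R)).
Proof.
move=> alpha x h H Q A.
have /andP[d0 d1] := delta01; have /andP[l0 l1] := lambda01.
have Hle : {homo H : s t / (s <= t)%N >-> s <= t}.
  by apply/nondecreasing_seqP => k; exact: (path_H_ndecr _ _ _ delta01 lambda01 _ _ mpe).
have cH : cvgn H.
  apply: nondecreasing_is_cvgn => //.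
  exists (umax u j0 x0) => _ [t _ <-].
  by have /andP[] := path_H_bounds u delta delta01 phi z a0 j0 x0 t.
split; first by move=> t; exact: (path_h_le_A _ _ _ delta01 lambda01 _ _ mpe).
split; first by move=> t; exact: (path_H_ndecr _ _ _ delta01 lambda01 _ _ mpe).
exists (limn H).
have [hL AL QL] := path_cvg u delta lambda delta01 lambda01 phi z mpe a0 _ cH.
(* From here on the lag is [k.+1], which turns the exponent [k - 1] into [k]. *)
split=> // -[//|k] _ loss; rewrite subn1 /=.
set D := lambda * _ * _.
have D0 : 0 < D by rewrite !mulr_gt0 ?exprn_gt0 ?subr_gt0.
have loss_ge0 t : 0 <= loss t by rewrite subr_ge0; exact: (path_h_ge _ _ _ _ _ mpe).
(* The per-period bounds telescope to [H m - H 0], and the nondecreasing [H] stays below its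
   limit. *)
have loss_sum m : series loss m <= (1 - lambda) * (limn H - H 0%N) / D.
  apply: (@le_trans _ _ ((1 - lambda) * (H m - H 0%N) / D)).
    rewrite -(telescope_sumr H (leq0n m)) mulr_sumr mulr_suml.
    by apply: ler_sum => t _; exact: (path_loss_le _ _ _ delta01 lambda01 _ _ mpe).
  rewrite ler_pM2r ?invr_gt0 // ler_pM2l ?subr_gt0 // lerD2r.
  exact: nondecreasing_cvgn_le.
have closs : cvgn (series loss).
  apply: nondecreasing_is_cvgn.
    by apply/nondecreasing_seqP => m; rewrite /series /= big_nat_recr //= lerDl.
  by exists ((1 - lambda) * (limn H - H 0%N) / D) => _ [m _ <-].
split=> //; split; first by split=> //; apply: limr_le => //; exact: nearW.
split; last exact: cvg_series_cvg_0.
rewrite ler_pM2r ?invr_gt0 // ler_pM2l ?subr_gt0 //.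
(* It remains to compare [limn H] with [umax] and [H 0] with [umin]. *)
have Hb := path_H_bounds u delta delta01 phi z a0 j0 x0.
apply: lerB; last by have /andP[] := Hb 0%N.
by apply: limr_le => //; apply: nearW => t; have /andP[] := Hb t.
Qed.
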